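(* Let $X$ be a real Hilbert space and $Y$ a real reflexive Banach space. Let $F\colon X \to Y$ be a continuous function and let $L > 0$. Then the following are equivalent: (i) $F$ is Fréchet differentiable on $X$ and its derivative $F'\colon X \to \mathcal{B}(X,Y)$ is $L$-Lipschitz continuous, i.e. $\|F'(x) - F'(y)\| \le L\|x-y\|$ for all $x,y \in X$, where the norm on the left is the operator norm; (ii) for every $n \ge 1$, all $x_1,\ldots,x_n \in X$ and all $\lambda_1,\ldots,\lambda_n \ge 0$ with $\sum_{i=1}^n \lambda_i = 1$, $$\Big\| F\Big(\sum_{i=1}^n \lambda_i x_i\Big) - \sum_{i=1}^n \lambda_i F(x_i)\Big\| \le \frac{L}{2}\sum_{1\le i<j\le n} \lambda_i\lambda_j \|x_i - x_j\|^2.$$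
   Context: $\mathcal{B}(X,Y)$ denotes the space of bounded linear operators from $X$ to $Y$, equipped with the operator norm $\|T\| = \sup_{\|x\|\le 1}\|T(x)\|$. The same symbol $\|\cdot\|$ denotes the norms on all the spaces involved. *)

(* Defs.v *)
From HB Require Import structures.
From mathcomp Require Import all_boot all_order all_algebra.
From mathcomp Require Import all_classical all_reals all_analysis.
Set Implicit Arguments. Unset Strict Implicit. Unset Printing Implicit Defensive.
Import Order.TTheory GRing.Theory Num.Theory.
Import numFieldNormedType.Exports.
Local Open Scope classical_set_scope.
Local Open Scope ring_scope.

Definition opnorm {R : realType} {V W : normedModType R} (T : V -> W) : R :=
  sup [set `|T u| | u in [set u : V | `|u| <= 1]].

(* The norm of X is induced by the real inner product [inner]
   (X is then a real Hilbert space when it is complete). *)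
Definition is_inner_product {R : realType} {X : normedModType R}
  (inner : X -> X -> R) : Prop :=
  (forall x y, inner x y = inner y x) /\
  (forall a x y z, inner (a *: x + y) z = a * inner x z + inner y z) /\
  (forall x, `|x| ^+ 2 = inner x x).

Definition dual_elt {R : realType} {Y : normedModType R} (f : Y -> R) : Prop :=
  (forall a u v, f (a *: u + v) = a * f u + f v) /\ continuous f.

Definition reflexive_space {R : realType} (Y : normedModType R) : Prop :=
  forall Phi : (Y -> R) -> R,
    (forall a f g, dual_elt f -> dual_elt g ->
       Phi (fun u => a * f u + g u) = a * Phi f + Phi g) ->
    (exists C : R, forall f, dual_elt f -> `|Phi f| <= C * opnorm f) ->
    exists y : Y, forall f, dual_elt f -> Phi f = f y.

(* Main.v *)
Require Import Defs.
From HB Require Import structures.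
From mathcomp Require Import all_boot all_order all_algebra.
From mathcomp Require Import all_classical all_reals all_analysis.
From mathcomp Require Import ring lra.
Import Order.TTheory GRing.Theory Num.Theory.
Import numFieldNormedType.Exports.
Local Open Scope classical_set_scope.
Local Open Scope ring_scope.

(** From (i) to (ii): a mean value argument gives
    [|F (x + v) - F x - F'(x) v| <= L / 2 |v|^2]; average it over
    [v = x_i - m] with [m] the barycentre, where the linear terms cancel, and
    use [sum_(i<j) l_i l_j |x_i - x_j|^2 = sum_i l_i |x_i - m|^2].

    From (ii) to (i), two points suffice.  The two-point inequality extends to
    extrapolation, so [t |-> (F (x + t v) - F x) / t] is Lipschitz away from
    [0] and has a limit [D v] there by completeness of [Y].  The resulting
    quadratic error bound forces [D] to be linear, and continuous because [F]
    is.  The sharp Lipschitz constant comes from comparing the first-order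
    expansions at [x] and [y] of the values of [F] at the two points
    [(x + y) / 2 + w] and [(x + y) / 2 - w], the errors being added up by the
    parallelogram law. *)

(** * Reflective decision of identities between linear combinations *)

Inductive lmod_term (K : Type) :=
  | LAtom of nat | LZero | LAdd of lmod_term K & lmod_term K
  | LOpp of lmod_term K | LScale of K & lmod_term K.
Arguments LAtom {K}. Arguments LZero {K}.
Arguments LAdd {K}. Arguments LOpp {K}. Arguments LScale {K}.

Fixpoint lmod_eval {K : pzRingType} {V : lmodType K} (env : seq V)
    (t : lmod_term K) : V :=
  match t with
  | LAtom i => nth 0 env i
  | LZero => 0
  | LAdd a b => lmod_eval env a + lmod_eval env b
  | LOpp a => - lmod_eval env a
  | LScale c a => c *: lmod_eval env a
  end.

(** The test is [Nat.eqb] so that [simpl] evaluates it on concrete indices and leaves plain scalar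
    expressions. *)
Fixpoint lmod_coef {K : pzRingType} (t : lmod_term K) (i : nat) : K :=
  match t with
  | LAtom j => if Nat.eqb j i then 1 else 0
  | LZero => 0
  | LAdd a b => lmod_coef a i + lmod_coef b i
  | LOpp a => - lmod_coef a i
  | LScale c a => c * lmod_coef a i
  end.

Lemma lmod_evalE (K : pzRingType) (V : lmodType K) (env : seq V) t :
  lmod_eval env t = \sum_(i < size env) lmod_coef t i *: nth 0 env i.
Proof.
elim: t => [j||a IHa b IHb|a IHa|c a IHa] /=; rewrite ?IHa ?IHb.
- have [ltj|gej] := ltnP j (size env).
    rewrite (bigD1 (Ordinal ltj)) //= big1 ?addr0 => [|i neq].
      by rewrite PeanoNat.Nat.eqb_refl scale1r.
    case: PeanoNat.Nat.eqb_spec => [eji|_]; last by rewrite scale0r.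
    by case/eqP: neq; apply: val_inj.
  rewrite nth_default // big1 // => i _.
  case: PeanoNat.Nat.eqb_spec => [eji|_]; last by rewrite scale0r.
  by have := ltn_ord i; rewrite -eji ltnNge gej.
- by rewrite big1 // => i _; rewrite scale0r.
- by rewrite -big_split; apply: eq_bigr => i _; rewrite scalerDl.
- by rewrite -sumrN; apply: eq_bigr => i _; rewrite scaleNr.
- by rewrite scaler_sumr; apply: eq_bigr => i _; rewrite scalerA.
Qed.

(** A bounded quantifier that [simpl] unfolds to a conjunction, which [split] then cuts into one
    goal per atom. *)
Fixpoint all_below (n : nat) (P : nat -> Prop) : Prop :=
  if n is m.+1 then P m /\ all_below m P else True.

Lemma lmod_eq (K : pzRingType) (V : lmodType K) (env : seq V) t u :
  all_below (size env) (fun i => lmod_coef t i = lmod_coef u i) ->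
  lmod_eval env t = lmod_eval env u.
Proof.
move=> H; rewrite !lmod_evalE; apply: eq_bigr => -[i lti] _ /=; congr (_ *: _).
elim: (size env) lti H => [//|n IH] /=.
by rewrite ltnS leq_eqVlt => /orP[/eqP -> []//|ltin [_ /(IH ltin)]].
Qed.

(* Atoms are compared by conversion, as the same vector may be elaborated with
   different structure instances. *)
Ltac lmod_index a env :=
  match env with
  | nil => constr:(@None nat)
  | cons ?b ?l =>
    match goal with
    | _ => let _ := match goal with _ => unify a b end in constr:(Some O)
    | _ => match lmod_index a l with
           | Some ?n => constr:(Some (S n)) | None => constr:(@None nat) end
    end
  end.
Ltac lmod_atoms env t :=
  match t with
  | (0)%R => env
  | (?a + ?b)%R => let e := lmod_atoms env a in lmod_atoms e b
  | (- ?a)%R => lmod_atoms env a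
  | (_ *: ?a)%R => lmod_atoms env a
  | ?a => match lmod_index a env with
          | Some _ => env | None => constr:(cons a env) end
  end.
Ltac lmod_quote K env t :=
  match t with
  | (0)%R => constr:(@LZero K)
  | (?a + ?b)%R =>
    let a := lmod_quote K env a in let b := lmod_quote K env b in
    constr:(@LAdd K a b)
  | (- ?a)%R => let a := lmod_quote K env a in constr:(@LOpp K a)
  | (?c *: ?a)%R => let a := lmod_quote K env a in constr:(@LScale K c a)
  | ?a => match lmod_index a env with Some ?n => constr:(@LAtom K n) end
  end.
(* Reduces an identity between linear combinations in an lmodType over [K] to
   one scalar goal per atom. *)
Ltac lmod K :=
  match goal with
  | |- ?l = ?r :> ?V =>
    let e := lmod_atoms (@nil V) l in let e := lmod_atoms e r in
    let l' := lmod_quote (K : Type) e l in let r' := lmod_quote (K : Type) e r in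
    apply: (@lmod_eq K _ e l' r'); simpl; repeat split
  end.

(** * Extrapolation and difference quotients *)

Section TwoPoint.
Context {R : realType} {X Y : normedModType R} (F : X -> Y) (C : R).

Hypothesis two_point : forall x v s, 0 <= s <= 1 ->
  `|F (x + s *: v) - F x - s *: (F (x + v) - F x)|
    <= C * (s * (1 - s)) * `|v| ^+ 2.

(* For [s] outside [[0, 1]], one of the three points [x], [x + v], [x + s v] is
   still between the other two. *)
Lemma two_point_extrapolation x v s :
  `|F (x + s *: v) - F x - s *: (F (x + v) - F x)|
    <= C * `|s * (1 - s)| * `|v| ^+ 2.
Proof.
have [s_lt0|s_ge0] := ltP s 0; last have [s_le1|s_gt1] := leP s 1.
- have s1 : 0 < 1 - s by lra.
  have -> : F (x + s *: v) - F x - s *: (F (x + v) - F x)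
    = - ((1 - s) *: (F (x + v + (1 - s)^-1 *: ((s - 1) *: v)) - F (x + v) -
        (1 - s)^-1 *: (F (x + v + (s - 1) *: v) - F (x + v)))).
    have -> : x + v + (1 - s)^-1 *: ((s - 1) *: v) = x.
      by lmod R; field; lra.
    have -> : x + v + (s - 1) *: v = x + s *: v by lmod R; ring.
    by lmod R; field; lra.
  rewrite normrN normrZ (gtr0_norm s1) [`|s * _|]ler0_norm; last nra.
  have s1V : 0 <= (1 - s)^-1 <= 1.
    by rewrite invr_ge0 ltW //= invf_le1 //; lra.
  have := two_point (x + v) ((s - 1) *: v) _ s1V.
  rewrite -(ler_pM2l s1) => /le_trans; apply.
  rewrite normrZ ler0_norm; last lra.
  by rewrite le_eqVlt; apply/orP; left; apply/eqP; field; lra.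
- rewrite [`|s * _|]ger0_norm; last nra.
  by apply: two_point; rewrite s_ge0.
- have s0 : 0 < s by lra.
  have -> : F (x + s *: v) - F x - s *: (F (x + v) - F x)
    = - (s *: (F (x + s^-1 *: (s *: v)) - F x - s^-1 *: (F (x + s *: v) - F x))).
    rewrite scalerA mulVf ?scale1r; last lra.
    by lmod R; field; lra.
  rewrite normrN normrZ (gtr0_norm s0) [`|s * _|]ler0_norm; last nra.
  have sV : 0 <= s^-1 <= 1 by rewrite invr_ge0 ltW //= invf_le1 //; lra.
  have := two_point x (s *: v) _ sV.
  rewrite -(ler_pM2l s0) => /le_trans; apply.
  rewrite normrZ (gtr0_norm s0).
  by rewrite le_eqVlt; apply/orP; left; apply/eqP; field; lra.
Qed.

(** Extrapolate along [t *: v] with parameter [s / t], then divide by |s|: the factor |s / t (1 - s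
    / t)| t^2 / |s| is exactly |s - t|. *)
Lemma difference_quotient_lipschitz x v s t : s != 0 -> t != 0 ->
  `|s^-1 *: (F (x + s *: v) - F x) - t^-1 *: (F (x + t *: v) - F x)|
    <= C * `|s - t| * `|v| ^+ 2.
Proof.
move=> s0 t0.
have -> : s^-1 *: (F (x + s *: v) - F x) - t^-1 *: (F (x + t *: v) - F x)
  = s^-1 *: (F (x + (s / t) *: (t *: v)) - F x
      - (s / t) *: (F (x + t *: v) - F x)).
  rewrite scalerA divfK //.
  by lmod R; field; rewrite ?s0 ?t0.
rewrite normrZ normfV ler_pdivrMl ?normr_gt0 //.
apply: le_trans (two_point_extrapolation _ _ _) _.
rewrite (normrZ t v) exprMn real_normK ?num_real //.
have -> : `|s / t * (1 - s / t)| = `|s| * `|s - t| / t ^+ 2.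
  have -> : s / t * (1 - s / t) = - (s * (s - t) / t ^+ 2) by field.
  by rewrite normrN !normrM normfV normrX real_normK ?num_real.
by rewrite le_eqVlt; apply/orP; left; apply/eqP; field.
Qed.

End TwoPoint.

(** * Directional derivatives and their linearity *)

Lemma two_point_directional (R : realType) (X : normedModType R)
    (Y : completeNormedModType R) (F : X -> Y) (C : R) :
  (forall x v s, 0 <= s <= 1 ->
    `|F (x + s *: v) - F x - s *: (F (x + v) - F x)|
      <= C * (s * (1 - s)) * `|v| ^+ 2) ->
  forall x v, exists w, forall t,
    `|F (x + t *: v) - F x - t *: w| <= C * t ^+ 2 * `|v| ^+ 2.
Proof.
move=> two_point x v; set K := C * `|v| ^+ 2.
pose q t := t^-1 *: (F (x + t *: v) - F x).
have qK s t : s != 0 -> t != 0 -> `|q s - q t| <= K * `|s - t|.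
  move=> s0 t0; rewrite /K mulrAC.
  exact: difference_quotient_lipschitz two_point _ _ _ _ s0 t0.
have : cauchy (q @ (0 : R)^').
  apply: cauchy_exP => e e0.
  (* For |t| < s, |s - t| < 2 s and (|K| + 1) (2 s) = e, so [q s] can serve as the centre of the
     ball. The sign of [K] is not known, and adding 1 avoids division by zero. *)
  pose s := e / (`|K| + 1) / 2.
  have K1 : 0 < `|K| + 1 by have := normr_ge0 K; lra.
  have s0 : 0 < s by rewrite !divr_gt0.
  exists (q s) => /=; near=> t.
  rewrite -ball_normE /=.
  have t0 : t != 0 by near: t; exact: nbhs_dnbhs_neq.
  have ts : `|t| < s by near: t; exact: dnbhs0_lt.
  apply: le_lt_trans (qK _ _ (lt0r_neq0 s0) t0) _.
  have : `|s - t| < 2 * s by apply: le_lt_trans (ler_normB _ _) _; rewrite gtr0_norm //; lra.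
  have -> : e = (`|K| + 1) * (2 * s) by rewrite /s; field; lra.
  have := ler_norm K; have := normr_ge0 (s - t); have := normr_ge0 K.
  move: (`|K|) (`|s - t|) => k d; nra.
move=> /cauchy_cvgP/cvg_ex[w /= qw]; exists w => t.
have [->|t0] := eqVneq t 0.
  by rewrite !scale0r addr0 subrr subr0 normr0 expr0n /= mulr0 mul0r.
have -> : F (x + t *: v) - F x - t *: w = t *: (q t - w).
  by rewrite /q; lmod R; field.
have -> : C * t ^+ 2 * `|v| ^+ 2 = `|t| * (K * `|t|).
  rewrite /K -{1}(real_normK (num_real t)); ring.
rewrite normrZ ler_wpM2l //.
(* Letting s tend to 0 in [qK] gives |q t - w| <= K |t|. *)
have cv : (fun s => `|q t - q s|) @ (0 : R)^' --> `|q t - w|.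
  by apply: cvg_norm; apply: cvgB => //; exact: cvg_cst.
have cK : (fun s => K * `|t - s|) @ (0 : R)^' --> K * `|t|.
  rewrite -{2}(subr0 t); apply: cvgMr; apply: cvg_norm; apply: cvgB.
    exact: cvg_cst.
  exact: cvg_within_filter.
apply: ler_cvg_to cv cK _; near=> s; apply: qK => //.
by near: s; exact: nbhs_dnbhs_neq.
Unshelve. all: by end_near. Qed.

(** Division by t leaves |a| <= K t for every t > 0. This yields uniqueness of first-order
    coefficients. *)
Lemma small_multiple_eq0 (R : realType) (Y : normedModType R) (a : Y) (K : R) :
  (forall t, 0 < t -> `|t *: a| <= K * t ^+ 2) -> a = 0.
Proof.
move=> H; apply/eqP; rewrite -normr_le0; apply/ler_addgt0Pr => e e0.
rewrite add0r; have K1 : 0 < `|K| + 1 by have := normr_ge0 K; lra.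
have t0 : 0 < e / (`|K| + 1) by rewrite divr_gt0.
have := H _ t0; rewrite normrZ gtr0_norm // expr2 mulrCA ler_pM2l //.
move=> /le_trans; apply; rewrite mulrA ler_pdivrMr // mulrC ler_pM2l //.
by have := ler_norm K; lra.
Qed.

Lemma two_point_linear_model (R : realType) (X : normedModType R)
    (Y : completeNormedModType R) (F : X -> Y) (C : R) :
  (forall x v s, 0 <= s <= 1 ->
    `|F (x + s *: v) - F x - s *: (F (x + v) - F x)|
      <= C * (s * (1 - s)) * `|v| ^+ 2) ->
  forall x, exists D : {linear X -> Y}, forall v,
    `|F (x + v) - F x - D v| <= C * `|v| ^+ 2.
Proof.
move=> two_point x.
have [D DP] := choice (two_point_directional _ _ _ _ _ two_point x).
(* Homogeneity and additivity of [D] both follow by exhibiting the expected value as a first-order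
   coefficient with quadratic error. *)
have D_uniq v w K :
    (forall t, 0 < t -> `|F (x + t *: v) - F x - t *: w| <= K * t ^+ 2) ->
    D v = w.
  move=> wP; apply/eqP; rewrite -subr_eq0; apply/eqP.
  apply: (@small_multiple_eq0 _ _ _ (K + C * `|v| ^+ 2)) => t t0.
  have -> : t *: (D v - w) = (F (x + t *: v) - F x - t *: w)
     - (F (x + t *: v) - F x - t *: D v) by lmod R; ring.
  apply: le_trans (ler_normB _ _) _.
  rewrite mulrDl; apply: lerD; first exact: wP.
  by rewrite mulrAC; exact: DP.
have DZ a v : D (a *: v) = a *: D v.
  apply: (D_uniq _ _ (C * a ^+ 2 * `|v| ^+ 2)) => t _.
  rewrite !scalerA; apply: le_trans (DP _ _) _.
  by rewrite le_eqVlt; apply/orP; left; apply/eqP; ring.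
have DD u v : D (u + v) = D u + D v.
  (* The point x + t (u + v) is the midpoint of x + 2 t u and x + 2 t v. The first term of the
     constant is the midpoint error, the others are half the expansion errors at time 2 t. *)
  apply: (D_uniq _ _ (C * `|v - u| ^+ 2 + C * 2 * `|u| ^+ 2 + C * 2 * `|v| ^+ 2)) => t t0.
  have h01 : 0 <= (2^-1 : R) <= 1 by apply/andP; split; lra.
  have := two_point (x + (2 * t) *: u) ((2 * t) *: (v - u)) _ h01.
  have -> : x + (2 * t) *: u + 2^-1 *: ((2 * t) *: (v - u)) = x + t *: (u + v).
    by lmod R; field.
  have -> : x + (2 * t) *: u + (2 * t) *: (v - u) = x + (2 * t) *: v.
    by lmod R; ring.
  rewrite normrZ gtr0_norm; last lra.
  move=> H1; have := DP u (2 * t); have := DP v (2 * t) => H2 H3.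
  have -> : F (x + t *: (u + v)) - F x - t *: (D u + D v) =
    (F (x + t *: (u + v)) - F (x + (2 * t) *: u) -
       2^-1 *: (F (x + (2 * t) *: v) - F (x + (2 * t) *: u)))
    + (2^-1 *: (F (x + (2 * t) *: u) - F x - (2 * t) *: D u)
    + 2^-1 *: (F (x + (2 * t) *: v) - F x - (2 * t) *: D v)).
    by lmod R; field.
  apply: le_trans (ler_normD _ _) _.
  apply: le_trans (lerD H1 (ler_normD _ _)) _.
  rewrite (normrZ 2^-1) (normrZ 2^-1) gtr0_norm; last lra.
  move: H2 H3; set A := `|_|; set B := `|_| => H2 H3.
  move: (`|v - u|) (`|u|) (`|v|) H2 H3 => d e f H2 H3.
  lra.
have D_lin : linear D by move=> a u v; rewrite DD DZ.
pose Dl := HB.pack_for {linear X -> Y} D (GRing.isLinear.Build R X Y *:%R D D_lin).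
exists Dl => v; have := DP v 1.
by rewrite !scale1r expr1n mulr1.
Qed.

(** * Fréchet differentiability from a quadratic error bound *)

Lemma near0_sqr_le (R : realType) (X : normedModType R) (C e : R) : 0 < e ->
  \forall v \near (0 : X), C * `|v| ^+ 2 <= e * `|v|.
Proof.
move=> e0; have K1 : 0 < `|C| + 1 by have := normr_ge0 C; lra.
near=> v.
have vd : `|v| < e / (`|C| + 1) by near: v; apply: nbhs0_lt; rewrite divr_gt0.
rewrite expr2 mulrA; apply: ler_wpM2r => //.
move: vd; rewrite ltr_pdivlMr //.
by have := normr_ge0 v; have := ler_norm C; nra.
Unshelve. all: by end_near. Qed.

Lemma linear_model_diff (R : realType) (X Y : normedModType R) (F : X -> Y)
    (x : X) (D : {linear X -> Y}) (C : R) :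
  {for x, continuous F} ->
  (forall v, `|F (x + v) - F x - D v| <= C * `|v| ^+ 2) ->
  differentiable F x /\ 'd F x = D :> (X -> Y).
Proof.
move=> Fx FD.
(* By linearity, continuity at 0 is enough. There [D v] is an increment of [F], small by continuity
   at [x], minus a quadratic error. *)
have Dcont : continuous D.
  apply/linear_bounded_continuous; apply: continuous_linear_bounded.
  rewrite /prop_for /continuous_at linear0; apply/cvgr0Pnorm_le => e e0.
  have e2 : 0 < e / 2 by lra.
  have Fxv : \forall v \near (0 : X), `|F (x + v) - F x| <= e / 2.
    have : \forall y \near x, `|F x - F y| <= e / 2.
      by have /cvgrPdist_le/(_ _ e2) := Fx.
    rewrite (near_shift 0 x) /=.
    by apply: filterS => v /=; rewrite subr0 [v + x]addrC distrC.
  near=> v.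
  have v1 : `|v| <= 1 by near: v; exact: nbhs0_le.
  have H1 : `|F (x + v) - F x| <= e / 2 by near: v.
  have H2 : C * `|v| ^+ 2 <= e / 2 * `|v| by near: v; exact: near0_sqr_le.
  have -> : D v = (F (x + v) - F x) - (F (x + v) - F x - D v) by lmod R; ring.
  apply: le_trans (ler_normB _ _) _.
  have := FD v; nra.
have dE : F \o shift x = cst (F x) + D +o_ 0 id.
  apply/eqaddoP => e e0; near=> v.
  have H2 : C * `|v| ^+ 2 <= e * `|v| by near: v; exact: near0_sqr_le.
  apply: le_trans H2; apply: le_trans (FD v).
  rewrite (_ : (_ - _) v = F (x + v) - F x - D v) //.
  by rewrite -addrA -opprD [x + v]addrC.
have d := diff_unique Dcont dE.
by split=> //; apply/diff_locallyP; rewrite d.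
Unshelve. all: by end_near. Qed.

(** * Operator norm and mean value estimate *)

Lemma diff_near (R : realType) (X Y : normedModType R) (F : X -> Y) (x : X)
    (e : R) : differentiable F x -> 0 < e ->
  \forall h \near (0 : X), `|F (x + h) - F x - 'd F x h| <= e * `|h|.
Proof.
move=> /diff_locallyP[_ /eqaddoP dF] e0; have := dF _ e0.
apply: filterS => h; apply: le_trans.
rewrite (_ : (_ - _) h = F (h + x) - (F x + 'd F x h)) //.
by rewrite opprD addrA [h + x]addrC.
Qed.

(** Continuity bounds the set under [sup]; on an unbounded set [sup] is only a default value. *)
Lemma opnorm_ub (R : realType) (X Y : normedModType R) (T : {linear X -> Y})
    (u : X) : continuous T -> `|T u| <= opnorm T * `|u|.
Proof.
move=> /linear_bounded_continuous/linear_boundedP.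
move=> /pinfty_ex_gt0[M M0 MT].
have [->|u0] := eqVneq u 0; first by rewrite linear0 !normr0 mulr0.
have u1 : 0 < `|u| by rewrite normr_gt0.
rewrite -ler_pdivrMr // mulrC -[in leLHS](gtr0_norm u1) -normfV -normrZ -linearZ.
apply: ub_le_sup.
  exists M => _ [v /= v1 <-]; apply: le_trans (MT v) _.
  by rewrite -[leRHS]mulr1 ler_pM2l.
exists (`|u|^-1 *: u) => //=.
by rewrite normrZ normfV normr_id mulVf // gt_eqF.
Qed.

Lemma le_opnorm (R : realType) (X Y : normedModType R) (T : X -> Y) (K : R) :
  (forall u, `|u| <= 1 -> `|T u| <= K) -> opnorm T <= K.
Proof.
move=> TK; apply: ge_sup; last by move=> _ [u /= u1 <-]; exact: TK.
by exists `|T 0|; exists 0 => //=; rewrite normr0.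
Qed.

(** The remainder [g] on the segment has speed at most K t. In place of integration, [psi] is shown
    to be maximal on [0, 1] at 0, whence psi 1 <= psi 0 = 0. The slack [e] absorbs the first-order
    error of [F] and is arbitrary. *)
Lemma descent (R : realType) (X Y : normedModType R) (F : X -> Y) (L : R)
    (x v : X) :
  0 <= L -> (forall y, differentiable F y) ->
  (forall y u, `|'d F y u - 'd F x u| <= L * `|y - x| * `|u|) ->
  `|F (x + v) - F x - 'd F x v| <= L / 2 * `|v| ^+ 2.
Proof.
move=> L0 dF dFL; apply/ler_addgt0Pr => e e0.
pose K := L * `|v| ^+ 2.
have K0 : 0 <= K by rewrite mulr_ge0 // exprn_ge0.
pose g t := F (x + t *: v) - F x - t *: 'd F x v.
pose psi t := `|g t| - K / 2 * t ^+ 2 - e * t.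
have psic : continuous psi.
  move=> t; have gc : g @ t --> g t.
    apply: cvgB; last by apply: cvgZr_tmp; exact: cvg_id.
    apply: cvgB; last exact: cvg_cst.
    apply: continuous_cvg; first exact: differentiable_continuous.
    by apply: cvgD; [exact: cvg_cst | apply: cvgZr_tmp; exact: cvg_id].
  apply: cvgB; last by apply: cvgMr; exact: cvg_id.
  apply: cvgB; first exact: cvg_norm.
  by apply: cvgMr; exact: exprn_continuous.
(* At a maximum [c > 0] of [psi], the increment of [psi] over [c - tau, c] would
   be at most [K tau ^ 2 / 2 - e tau / 2 < 0]. *)
have [c c01 cmax] := EVT_max (ler01 : 0 <= (1 : R)) (continuous_subspaceT psic).
have [c_eq0|c_neq0] := eqVneq c 0.
  have := cmax 1 ltac:(by rewrite in_itv /= ler01 lexx).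
  rewrite c_eq0 /psi /g !scale1r !scale0r addr0 subrr subr0 normr0.
  rewrite expr1n expr0n /= !mulr0 !mulr1 /K; lra.
move: c01; rewrite in_itv /= => /andP[c_ge0 c_le1].
have c_gt0 : 0 < c by rewrite lt_def c_neq0.
set p := x + c *: v.
have v1 : 0 < `|v| + 1 by have := normr_ge0 v; lra.
have eta0 : 0 < e / 2 / (`|v| + 1) by rewrite !divr_gt0.
have /nbhs_norm0P[d /= d0 dP] := diff_near _ _ _ _ _ _ (dF p) eta0.
(* The conditions keep c - tau in [0, 1], put -tau v where the expansion at [p] is valid, and make K
   tau^2 / 2 - e tau / 2 negative. *)
have [tau [tau0 tauc taud tauK]] :
    exists tau, [/\ 0 < tau, tau <= c, tau * (`|v| + 1) < d & K * tau < e].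
  exists (Num.min c (Num.min (d / 2 / (`|v| + 1)) (e / 2 / (K + 1)))); split.
  - by rewrite !lt_min c_gt0 !divr_gt0 //; lra.
  - by rewrite ge_min lexx.
  - rewrite -ltr_pdivlMr // gt_min gt_min; apply/orP; right; apply/orP; left.
    by rewrite ltr_pM2r ?invr_gt0 //; lra.
  - have K1 : 0 < K + 1 by lra.
    set t := Num.min c _; have tle : t <= e / 2 / (K + 1).
      by rewrite /t !ge_min lexx !orbT.
    rewrite ler_pdivlMr // in tle.
    have t0 : 0 <= t.
      by rewrite /t !le_min c_ge0 !divr_ge0 //; lra.
    by nra.
have := dP (- (tau *: v)).
rewrite /= normrN normrZ gtr0_norm // ['d F p _]linearN ['d F p _]linearZ opprK => Hd.
have {Hd} Hd := Hd ltac:(have := normr_ge0 v; nra).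
have Hd2 : `|F (p - tau *: v) - F p + tau *: 'd F p v| <= e / 2 * tau.
  apply: le_trans Hd _; rewrite mulrAC -ler_pdivlMr ?invr_gt0 // invrK.
  by have := normr_ge0 v; have := mulr_gt0 e0 tau0; nra.
have cin : c - tau \in `[0, 1].
  by rewrite in_itv /=; apply/andP; split; lra.
have := cmax _ cin; rewrite /psi.
(* The first error is the expansion at [p]; the second is the Lipschitz bound on the derivative,
   with |p - x| = c |v|. *)
have gle : `|g c| <= `|g (c - tau)| + (e / 2 * tau + tau * (K * c)).
  have -> : g c = g (c - tau) + (- (F (p - tau *: v) - F p + tau *: 'd F p v)
      + tau *: ('d F p v - 'd F x v)).
    have -> : p - tau *: v = x + (c - tau) *: v by rewrite /p; lmod R; ring.
    by rewrite /g -/p; lmod R; ring.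
  apply: le_trans (ler_normD _ _) _; rewrite lerD2l.
  apply: le_trans (ler_normD _ _) _; rewrite normrN; apply: lerD => //.
  rewrite normrZ gtr0_norm // ler_pM2l //; apply: le_trans (dFL _ _) _.
  rewrite /p addrAC subrr add0r normrZ gtr0_norm // /K.
  by rewrite le_eqVlt; apply/orP; left; apply/eqP; ring.
move: gle; set A := `|_|; set B := `|_|; nra.
Qed.

(** * Hilbert space identities and the sharp Lipschitz constant *)

Section InnerProduct.
Context {R : realType} {X : normedModType R} (inner : X -> X -> R).
Hypothesis innerP : is_inner_product inner.

Lemma innerC x y : inner x y = inner y x.
Proof. by have [] := innerP. Qed.

Lemma innerDl x y z : inner (x + y) z = inner x z + inner y z.
Proof. by have [_ [/(_ 1 x y z)]] := innerP; rewrite scale1r mul1r. Qed.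

Lemma inner0l z : inner 0 z = 0.
Proof. by have := innerDl 0 0 z; rewrite addr0; lra. Qed.

Lemma innerZl a x z : inner (a *: x) z = a * inner x z.
Proof. by have [_ [/(_ a x 0 z)]] := innerP; rewrite inner0l !addr0. Qed.

Lemma inner_suml n (x : 'I_n -> X) z :
  inner (\sum_i x i) z = \sum_i inner (x i) z.
Proof.
by apply: (big_morph (inner ^~ z)) => [y y'|]; [exact: innerDl | exact: inner0l].
Qed.

Lemma normB_sqr (x y : X) : `|x - y| ^+ 2 = `|x| ^+ 2 + `|y| ^+ 2 - 2 * inner x y.
Proof.
have [_ [_ nE]] := innerP.
rewrite !nE -(scaleN1r y) innerDl innerZl !(innerC _ (x + _)) !innerDl !innerZl.
rewrite (innerC y x); ring.
Qed.

Lemma parallelogram (x y : X) :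
  `|x + y| ^+ 2 + `|x - y| ^+ 2 = 2 * `|x| ^+ 2 + 2 * `|y| ^+ 2.
Proof.
rewrite -{1}[y]opprK !normB_sqr normrN -(scaleN1r y) (innerC x (_ *: _)) innerZl (innerC y x).
ring.
Qed.

(** Expand |v i - v j|^2 for the centred points [v]: the inner products sum to zero because the
    weighted sum of [v] vanishes. *)
Lemma weighted_pair_sum n (x : 'I_n -> X) (lam : 'I_n -> R) :
  \sum_(i < n) lam i = 1 ->
  \sum_(i < n) \sum_(j < n | (i < j)%N) lam i * lam j * `|x i - x j| ^+ 2
  = \sum_(i < n) lam i * `|x i - \sum_(j < n) lam j *: x j| ^+ 2.
Proof.
move=> lam1; set m := \sum_(j < n) lam j *: x j.
pose v i := x i - m.
have xv i j : x i - x j = v i - v j by rewrite /v; lmod R; ring.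
have v0 : \sum_i lam i *: v i = 0.
  under eq_bigr do rewrite scalerBr.
  by rewrite sumrB -scaler_suml lam1 scale1r subrr.
pose f i j := lam i * lam j * `|x i - x j| ^+ 2.
have fC i j : f i j = f j i by rewrite /f distrC (mulrC (lam i)).
have f0 i : f i i = 0 by rewrite /f subrr normr0 expr0n mulr0.
(* The summand is symmetric and zero on the diagonal, so the full square counts each pair twice. *)
have half : \sum_i \sum_j f i j = 2 * \sum_(i < n) \sum_(j < n | (i < j)%N) f i j.
  rewrite mulr_natl mulr2n.
  under eq_bigr => i _ do rewrite (bigID (fun j : 'I_n => (i < j)%N)) /=.
  rewrite big_split /=; congr (_ + _).
  rewrite (exchange_big_dep xpredT) //=; apply: eq_bigr => i _.
  rewrite (bigD1 i) /= ?ltnn // f0 add0r; apply: eq_big => j.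
    by rewrite -leqNgt ltn_neqAle andbC eq_sym.
  by move=> _; exact: fC.
apply: (@mulfI _ 2); first by rewrite pnatr_eq0.
rewrite -half mulr_sumr.
transitivity (\sum_i (lam i * `|v i| ^+ 2 + (\sum_j lam j * `|v j| ^+ 2) * lam i)).
  apply: eq_bigr => i _.
  transitivity (\sum_j (lam i * `|v i| ^+ 2 * lam j
     + lam i * (lam j * `|v j| ^+ 2) - 2 * lam i * inner (lam j *: v j) (v i))).
    apply: eq_bigr => j _.
    by rewrite /f xv normB_sqr innerZl (innerC (v j)); ring.
  rewrite sumrB big_split /= -!mulr_sumr lam1 -inner_suml v0 inner0l.
  by ring.
rewrite big_split /= -!mulr_sumr lam1.
by ring.
Qed.

Lemma linear_models_lipschitz (Y : normedModType R) (F : X -> Y) (C : R)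
    (x y : X) (Dx Dy : {linear X -> Y}) : 0 <= C ->
  (forall v, `|F (x + v) - F x - Dx v| <= C * `|v| ^+ 2) ->
  (forall v, `|F (y + v) - F y - Dy v| <= C * `|v| ^+ 2) ->
  x != y -> forall u, `|u| <= 1 -> `|Dx u - Dy u| <= 2 * C * `|x - y|.
Proof.
move=> C0 HDx HDy xy u u1.
pose d := 2^-1 *: (x - y).
have d0 : 0 < `|d|.
  by rewrite normr_gt0 scaler_eq0 invr_eq0 pnatr_eq0 /= subr_eq0.
have -> : `|x - y| = 2 * `|d|.
  by rewrite /d normrZ gtr0_norm ?invr_gt0 // mulrA divff ?mul1r ?pnatr_eq0.
(* The error bound [2 C (|w|^2 + |d|^2)] is optimal for [|w| = |d|]. *)
pose w := `|d| *: u.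
have wd : `|w| ^+ 2 <= `|d| ^+ 2.
  rewrite ler_sqr ?nnegrE // normrZ normr_id.
  by rewrite -[leRHS]mulr1 ler_pM2l.
have key : 2 * `|Dx w - Dy w| <= 4 * C * (`|w| ^+ 2 + `|d| ^+ 2).
  (* Since x - d = y + d is the midpoint, these are the two points midpoint + w and midpoint - w. *)
  have E1 : x + (w - d) = y + (w + d) by rewrite /d; lmod R; field.
  have E2 : x + - (w + d) = y + - (w - d) by rewrite /d; lmod R; field.
  have := HDx (w - d); have := HDx (- (w + d)).
  have := HDy (w + d); have := HDy (- (w - d)).
  rewrite -E1 -E2 !normrN => H1 H2 H3 H4.
  have P := parallelogram w d.
  rewrite -[2](@gtr0_norm R) // -normrZ.
  (* Values of [F] at the two test points cancel inside each pair of errors; [F x], [F y] and the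
     terms in [d] cancel between the pairs. *)
  have -> : 2 *: (Dx w - Dy w) =
    - (((F (x + (w - d)) - F x - Dx (w - d))
      - (F (x + (w - d)) - F y - Dy (w + d)))
    - ((F (x - (w + d)) - F x - Dx (- (w + d)))
      - (F (x - (w + d)) - F y - Dy (- (w - d))))).
    rewrite !(linearN Dx) !(linearN Dy) !(linearB Dx) !(linearB Dy).
    by rewrite !(linearD Dx) !(linearD Dy); lmod R; ring.
  rewrite normrN; apply: le_trans (ler_normB _ _) _.
  apply: le_trans (lerD (ler_normB _ _) (ler_normB _ _)) _.
  apply: le_trans (lerD (lerD H4 H2) (lerD H3 H1)) _.
  rewrite (_ : 4 * C * _ = 2 * C * (2 * `|w| ^+ 2 + 2 * `|d| ^+ 2)); last ring.
  by rewrite -P le_eqVlt; apply/orP; left; apply/eqP; ring.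
rewrite -(ler_pM2l d0).
have -> : `|d| * `|Dx u - Dy u| = `|Dx w - Dy w|.
  by rewrite /w (linearZZ Dx) (linearZZ Dy) -scalerBr (normrZ `|d|) normr_id.
have : C * `|w| ^+ 2 <= C * `|d| ^+ 2 by exact: ler_wpM2l.
lra.
Qed.
End InnerProduct.

(** * Equivalence of the Lipschitz derivative and the barycentric inequality *)

Theorem theorem1p2 (R : realType) (X : completeNormedModType R)
  (inner : X -> X -> R) (Y : completeNormedModType R)
  (F : X -> Y) (L : R) :
  is_inner_product inner ->
  reflexive_space Y ->
  continuous F ->
  0 < L ->
  ((forall x : X, differentiable F x) /\
   (forall x y : X,
      opnorm (fun u : X => 'd F x u - 'd F y u) <= L * `|x - y|))
  <->
  (forall (n : nat) (x : 'I_n -> X) (lam : 'I_n -> R),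
     (0 < n)%N ->
     (forall i, 0 <= lam i) ->
     \sum_(i < n) lam i = 1 ->
     `|F (\sum_(i < n) lam i *: x i) - \sum_(i < n) lam i *: F (x i)|
       <= L / 2 * \sum_(i < n) \sum_(j < n | (i < j)%N)
                    lam i * lam j * `|x i - x j| ^+ 2).
Proof.
move=> innerP _ Fc L0; split.
- move=> [dF dFL] n x lam _ lam_ge0 lam1.
  rewrite (weighted_pair_sum _ innerP _ _ _ lam1).
  set m := \sum_(j < n) lam j *: x j.
  have quad v : `|F (m + v) - F m - 'd F m v| <= L / 2 * `|v| ^+ 2.
    apply: descent => [|//|y u]; first exact: ltW.
    have Dc : continuous ('d F y \- 'd F m).
      by move=> z; apply: cvgB; exact: diff_continuous.
    apply: le_trans (opnorm_ub _ _ _ _ u Dc) _.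
    by apply: ler_wpM2r => //; exact: dFL.
  rewrite distrC.
  (* The weighted sum of x i - m is zero, so the linear terms may be inserted freely. *)
  have -> : \sum_(i < n) lam i *: F (x i) - F m =
      \sum_(i < n) lam i *: (F (m + (x i - m)) - F m - 'd F m (x i - m)).
    under [RHS]eq_bigr do rewrite [m + _]addrC subrK !scalerBr -(linearZZ ('d F m)).
    rewrite !sumrB -scaler_suml lam1 scale1r -(linear_sum ('d F m)).
    under [X in 'd F m X]eq_bigr do rewrite scalerBr.
    by rewrite sumrB -scaler_suml lam1 scale1r -/m subrr linear0 subr0.
  apply: le_trans (ler_norm_sum _ _ _) _; rewrite mulr_sumr.
  apply: ler_sum => i _; rewrite normrZ ger0_norm //.
  by rewrite mulrCA; apply: ler_wpM2l.
move=> FP.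
(* The case n = 2, with weights 1 - s and s at x and x + v. *)
have two_point x v s : 0 <= s <= 1 ->
    `|F (x + s *: v) - F x - s *: (F (x + v) - F x)|
      <= L / 2 * (s * (1 - s)) * `|v| ^+ 2.
  move=> /andP[s0 s1].
  pose pt (i : 'I_2) := if i == ord0 then x else x + v.
  pose lam (i : 'I_2) := if i == ord0 then 1 - s else s.
  have := FP 2 pt lam isT.
  rewrite !big_ord_recl !big_ord0 !addr0 /=.
  rewrite big_mkcond !big_ord_recl big_ord0 /= addr0 add0r.
  rewrite big_mkcond !big_ord_recl big_ord0 /= !addr0.
  rewrite /pt /lam /=.
  have -> : (1 - s) *: x + s *: (x + v) = x + s *: v by lmod R; ring.
  have -> : F (x + s *: v) - ((1 - s) *: F x + s *: F (x + v)) =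
    F (x + s *: v) - F x - s *: (F (x + v) - F x) by lmod R; ring.
  have -> : x - (x + v) = - v by lmod R; ring.
  rewrite normrN subrK [(1 - s) * s]mulrC mulrA; apply=> // i.
  by case: ifP => // _; rewrite subr_ge0.
have [D DP] := choice (two_point_linear_model _ _ _ _ _ two_point).
have dF x : differentiable F x /\ 'd F x = D x :> (X -> Y).
  exact: linear_model_diff (Fc x) (DP x).
split=> [x|x y]; first by have [] := dF x.
apply: le_opnorm => u u1.
(* The comparison of expansions divides by |x - y| / 2, hence the separate case x = y. *)
have [->|xy] := eqVneq x y; first by rewrite !subrr !normr0 mulr0.
have [_ ->] := dF x; have [_ ->] := dF y.
have -> : L = 2 * (L / 2) by field.
apply: (linear_models_lipschitz _ innerP) (DP x) (DP y) xy _ u1.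
by rewrite divr_ge0 // ltW.
Qed.
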